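(* Let $R$ be a nearness ring on a nearness approximation space, $S$ a subnearness ring of $R$, and $R/_{\sim}$ the set of all weak cosets of $R$ by $S$. If $(N_r(B)^*R)/_{\sim}\subseteq N_r(B)^*(R/_{\sim})$, then $R/_{\sim}$ is a nearness ring under the operations given by $(x+S)\oplus(y+S)=(x+y)+S$ and $(x+S)\odot(y+S)=(x\cdot y)+S$ for all $x,y\in R$.
   Context: Nearness approximation space (NAS): $\mathcal{O}$ is a set (of perceptual objects), $\mathcal{F}$ a set of functions $\mathcal{O}\to\mathbb{R}$ (probe functions), $B\subseteq\mathcal{F}$, and $r\le |B|$. For each $B_r\subseteq B$ with $|B_r|=r$, put $x\sim_{B_r}x'$ iff $\varphi(x)=\varphi(x')$ for all $\varphi\in B_r$, with equivalence classes $[x]_{B_r}$. The NAS is the tuple $(\mathcal{O},\mathcal{F},\sim_{B_r},N_r(B),\nu_{N_r})$, where $N_r(B)$ is the collection of partitions $\mathcal{O}/\sim_{B_r}$ over all such $B_r$, and $\nu_{N_r}:\mathcal{P}(\mathcal{O})\times\mathcal{P}(\mathcal{O})\to[0,1]$ is an overlap function (not used in the definitions below). For $X\subseteq\mathcal{O}$ the upper approximation is $N_r(B)^*X=\bigcup\{[x]_{B_r} : x\in\mathcal{O},\ B_r\subseteq B,\ |B_r|=r,\ [x]_{B_r}\cap X\ne\emptyset\}$. Let $+$ and $\cdot$ be binary operations on $\mathcal{O}$. That an identity ''holds in $N_r(B)^*X$'' means that both sides are equal and their common value lies in $N_r(B)^*X$. Near group: $G\subseteq\mathcal{O}$ is a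 near group under an operation $*$ if (1) $x*y\in N_r(B)^*G$ for all $x,y\in G$; (2) for all $x,y,z\in G$, $(x*y)*z=x*(y*z)$ holds in $N_r(B)^*G$; (3) there is $e\in N_r(B)^*G$ (near identity) with $x*e=e*x=x$ for all $x\in G$; (4) for every $x\in G$ there is $y\in G$ (near inverse) with $x*y=y*x=e$. It is abelian if $x*y=y*x$ holds in $N_r(B)^*G$ for all $x,y\in G$. A nonempty $T\subseteq\mathcal{O}$ is a near semigroup if (1) and (2) hold for $T$. Nearness ring: $R\subseteq\mathcal{O}$ is a nearness ring if $(R,+)$ is an abelian near group, $(R,\cdot)$ is a near semigroup, and for all $x,y,z\in R$ both $x\cdot(y+z)=x\cdot y+x\cdot z$ and $(x+y)\cdot z=x\cdot z+y\cdot z$ hold in $N_r(B)^*R$. A subnearness ring of $R$ is a nonempty subset $S\subseteq R$ that is itself a nearness ring under the operations $+,\cdot$. Weak cosets: for $x\in N_r(B)^*R$, $x+S=\{x+s : s\in S,\ x+s\in R\}\cup\{x\}$. Put $R/_{\sim}=\{x+S : x\in R\}$ and $(N_r(B)^*R)/_{\sim}=\{x+S : x\in N_r(B)^*R\}$. For $x,y\in R$, $(x+S)\oplus(y+S)=(x+y)+S$ and $(x+S)\odot(y+S)=(x\cdot y)+S$, the right-hand sides being the weak cosets of $x+y,\ x\cdot y\in N_r(B)^*R$; the same formulas are used when iterating the operations. Upper approximation of $R/_{\sim}$: $\Phi(x)=(\varphi_1(x),\dots,\varphi_L(x))$ is the object description of $x\in\mathcal{O}$ given by probe functions $\varphi_i\in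 B$. For $A\subseteq\mathcal{O}$, $\mathcal{Q}(A)=\{\Phi(a):a\in A\}$. Sets $A,C\subseteq\mathcal{O}$ are descriptively near, $A\,\delta_\Phi\,C$, if $\mathcal{Q}(A)\cap\mathcal{Q}(C)\ne\emptyset$, and $\xi_\Phi(A)=\{C\in\mathcal{P}(\mathcal{O}) : A\,\delta_\Phi\,C\}$. For a subset $A\subseteq\mathcal{O}$ regarded as an object one writes $\Phi(A)=\{\Phi(a):a\in A\}$, and for a family $\mathcal{A}\subseteq\mathcal{P}(\mathcal{O})$, $\mathcal{Q}(\mathcal{A})=\{\Phi(A):A\in\mathcal{A}\}$; the descriptive intersection of two families is $\mathcal{A}\underset{\Phi}{\cap}\mathcal{C}=\{X\in\mathcal{A}\cup\mathcal{C} : \Phi(X)\in\mathcal{Q}(\mathcal{A})\text{ and }\Phi(X)\in\mathcal{Q}(\mathcal{C})\}$. Then $N_r(B)^*(R/_{\sim})=\bigcup\{\xi_\Phi(A) : A\in\mathcal{P}(\mathcal{O}),\ \xi_\Phi(A)\underset{\Phi}{\cap}R/_{\sim}\ne\emptyset\}$. ''$R/_{\sim}$ is a nearness ring'' means that the nearness ring axioms hold for $R/_{\sim}\subseteq\mathcal{P}(\mathcal{O})$ with $\oplus,\odot$ in place of $+,\cdot$ and with $N_r(B)^*(R/_{\sim})$ as its upper approximation.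
   Formalization: The formulas for ⊕ and ⊙ need not be independent of representatives (R=F_4, S=F_2), so the axioms are proved on representatives, and for actual operations on subsets only when these satisfy both formulas for x, y in the upper approximation of R whose sum or product lies there. *)

(* Defs.v *)
From HB Require Import structures.
From mathcomp Require Import all_boot all_order all_algebra.
From mathcomp Require Import all_classical all_reals.

Set Implicit Arguments.
Unset Strict Implicit.
Unset Printing Implicit Defensive.

Import Order.TTheory GRing.Theory Num.Theory.
Local Open Scope classical_set_scope.
Local Open Scope ring_scope.

(* The relations ~_{B_r} and the family N_r(B) of their partitions are
   determined by the other components of the space, so they are not fields. *)
Record nas (K : realType) := NAS {
  obj :> Type;
  probes : set (obj -> K);
  probesB : set (obj -> K);
  probesB_sub : probesB `<=` probes;
  nas_r : nat;
  nas_r_le : (`I_nas_r #<= probesB)%card;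
  overlap : set obj -> set obj -> K;
  overlap_itv : forall X Y, 0 <= overlap X Y <= 1 }.

Arguments probes {K} n.
Arguments probesB {K} n.

Definition r_subsets (K : realType) (O : nas K) : set (set (O -> K)) :=
  [set Br | Br `<=` probesB O /\ (Br #= `I_(nas_r O))%card].

Arguments r_subsets {K} O.

Definition indisc (K : realType) (O : nas K) (Br : set (O -> K)) (x y : O) :
  Prop := forall phi, Br phi -> phi x = phi y.

Definition indisc_class (K : realType) (O : nas K) (Br : set (O -> K)) (x : O) :
  set O := [set y | indisc Br x y].

Definition upper (K : realType) (O : nas K) (X : set O) : set O :=
  \bigcup_(Br in r_subsets O)
    \bigcup_(x in [set x | indisc_class Br x `&` X !=set0]) indisc_class Br x.

(* The near axioms are stated for an operation [op] on representatives [i : I]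
   of objects [val i : T], so that they make sense for an operation on objects
   prescribed by a formula val i * val j := val (op i j), including when the
   formula is iterated through its own result.  Equality is equality of the
   represented objects.  G and U are the representatives of the elements of the
   structure and of its upper approximation.  For [val := id] these are the
   axioms for an ordinary binary operation on T. *)
Definition holds_in (I T : Type) (val : I -> T) (U : set I) (a b : I) : Prop :=
  val a = val b /\ U a.

Definition near_closed (I : Type) (G U : set I) (op : I -> I -> I) : Prop :=
  forall x y, G x -> G y -> U (op x y).

Definition near_assoc (I T : Type) (val : I -> T) (G U : set I)
    (op : I -> I -> I) : Prop :=
  forall x y z, G x -> G y -> G z ->
    holds_in val U (op (op x y) z) (op x (op y z)).

Definition near_group (I T : Type) (val : I -> T) (G U : set I)
    (op : I -> I -> I) : Prop :=
  [/\ near_closed G U op,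
      near_assoc val G U op
    & exists2 e, U e &
        (forall x, G x -> val (op x e) = val x /\ val (op e x) = val x) /\
        (forall x, G x ->
           exists2 y, G y & val (op x y) = val e /\ val (op y x) = val e)].

Definition near_abelian_group (I T : Type) (val : I -> T) (G U : set I)
    (op : I -> I -> I) : Prop :=
  near_group val G U op /\
  forall x y, G x -> G y -> holds_in val U (op x y) (op y x).

Definition near_semigroup (I T : Type) (val : I -> T) (G U : set I)
    (op : I -> I -> I) : Prop :=
  [/\ G !=set0, near_closed G U op & near_assoc val G U op].

Definition nearness_ring_via (I T : Type) (val : I -> T) (G U : set I)
    (add mul : I -> I -> I) : Prop :=
  [/\ near_abelian_group val G U add,
      near_semigroup val G U mul,
      forall x y z, G x -> G y -> G z ->
        holds_in val U (mul x (add y z)) (add (mul x y) (mul x z))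
    & forall x y z, G x -> G y -> G z ->
        holds_in val U (mul (add x y) z) (add (mul x z) (mul y z))].

Definition nearness_ring (T : Type) (G U : set T) (add mul : T -> T -> T) :
  Prop := nearness_ring_via id G U add mul.

Definition subnearness_ring (K : realType) (O : nas K) (add mul : O -> O -> O)
    (R S : set O) : Prop :=
  [/\ S !=set0, S `<=` R & nearness_ring S (upper S) add mul].

Definition weak_coset (T : Type) (add : T -> T -> T) (R S : set T) (x : T) :
  set T := [set add x s | s in [set s | S s /\ R (add x s)]] `|` [set x].

Definition weak_cosets (T : Type) (add : T -> T -> T) (R S X : set T) :
  set (set T) := weak_coset add R S @` X.

Definition descr (K : realType) (T : Type) (L : nat) (phi : 'I_L -> T -> K)
  (x : T) : 'rV[K]_L := \row_i phi i x.

(* Both the set Q(A) of descriptions of the members of A, and the description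
   Phi(A) of A regarded as an object. *)
Definition set_descr (K : realType) (T : Type) (L : nat) (phi : 'I_L -> T -> K)
  (A : set T) : set 'rV[K]_L := descr phi @` A.

Definition descr_near (K : realType) (T : Type) (L : nat)
    (phi : 'I_L -> T -> K) (A C : set T) : Prop :=
  set_descr phi A `&` set_descr phi C !=set0.

Definition near_collection (K : realType) (T : Type) (L : nat)
    (phi : 'I_L -> T -> K) (A : set T) : set (set T) :=
  [set C | descr_near phi A C].

Definition family_descr (K : realType) (T : Type) (L : nat)
    (phi : 'I_L -> T -> K) (AA : set (set T)) : set (set 'rV[K]_L) :=
  set_descr phi @` AA.

Definition descr_cap (K : realType) (T : Type) (L : nat)
    (phi : 'I_L -> T -> K) (AA CC : set (set T)) : set (set T) :=
  [set X | [/\ (AA `|` CC) X, family_descr phi AA (set_descr phi X)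
             & family_descr phi CC (set_descr phi X)]].

Definition upper_family (K : realType) (T : Type) (L : nat)
    (phi : 'I_L -> T -> K) (RR : set (set T)) : set (set T) :=
  \bigcup_(A in [set A | descr_cap phi (near_collection phi A) RR !=set0])
    near_collection phi A.

(* R/~ under the formulas (x+S) (+) (y+S) = (x+y)+S, (x+S) (.) (y+S) = (x.y)+S
   read on representatives: S is not an ideal, so these formulas need not be
   independent of the representatives.  Representatives range over N_r(B)^*R,
   where weak cosets are defined. *)
Definition coset_nearness_ring (K : realType) (O : nas K) (L : nat)
    (phi : 'I_L -> O -> K) (add mul : O -> O -> O) (R S : set O) : Prop :=
  let coset := weak_coset add R S in
  let RS := weak_cosets add R S R in
  nearness_ring_via coset
    (upper R `&` coset @^-1` RS)
    (upper R `&` coset @^-1` upper_family phi RS) add mul.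

(* [cop] is an actual operation on subsets that obeys the formula for [op], at
   all weak cosets for which the right-hand side is again a weak coset. *)
Definition coset_operation (K : realType) (O : nas K) (add : O -> O -> O)
    (R S : set O) (op : O -> O -> O) (cop : set O -> set O -> set O) : Prop :=
  forall x y, upper R x -> upper R y -> upper R (op x y) ->
    cop (weak_coset add R S x) (weak_coset add R S y)
    = weak_coset add R S (op x y).

(* Main.v *)
Require Import Defs.
From HB Require Import structures.
From mathcomp Require Import all_boot all_order all_algebra.
From mathcomp Require Import all_classical all_reals.
Set Implicit Arguments.
Unset Strict Implicit.
Unset Printing Implicit Defensive.
Import Order.TTheory GRing.Theory Num.Theory.
Local Open Scope classical_set_scope.
Local Open Scope ring_scope.

(** The operations on weak cosets are read on representatives, so every axiom
for $R/_\sim$ is the image under the coset map of the same axiom for $R$: two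
equal elements have equal cosets ([nearness_ring_viaW]).

Two points remain.  Which representatives have to be considered: a weak coset of
a point of $R$ is contained in $R$ and every weak coset contains its own
representative, so a coset belonging to $R/_\sim$ is represented by points of
$R$ only ([coset_rep_mem]), and the near axioms of $R$ apply to all of them.
Where the results lie: sums and products stay in the upper approximation of $R$,
and the assumed inclusion sends the cosets of its points into the upper
approximation of $R/_\sim$.

For actual operations on subsets that obey the two formulas, the formulas may be
iterated because each intermediate result lies in the upper approximation of
$R$, which is where they are valid ([nearness_ring_image]). *)

(** Passing to images only weakens the equations of the axioms, and leaves the
membership conditions alone. *)
Lemma nearness_ring_viaW (I T : Type) (f : I -> T) (G U : set I)
    (add mul : I -> I -> I) :
  nearness_ring G U add mul -> nearness_ring_via f G U add mul.
Proof.
have W a b : holds_in id U a b -> holds_in f U a b.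
  by move=> [/= -> Ub]; split.
move=> [[[addU addA [e Ue [adde addV]]] addC] [G0 mulU mulA] mulDr mulDl].
split.
- split; last by move=> x y Gx Gy; exact/W/addC.
  split=> //; first by move=> x y z Gx Gy Gz; exact/W/addA.
  exists e => //; split=> [x /adde[/= -> ->]//|x /addV[y Gy /= [xy yx]]].
  by exists y; rewrite ?xy ?yx.
- by split=> // x y z Gx Gy Gz; exact/W/mulA.
- by move=> x y z Gx Gy Gz; exact/W/mulDr.
- by move=> x y z Gx Gy Gz; exact/W/mulDl.
Qed.

(** In each axiom all the subterms, and not only the two sides, lie in [U]: the
correspondence between the operations is used only where it is assumed. *)
Lemma nearness_ring_image (I T : Type) (f : I -> T) (G U : set I) (V : set T)
    (add mul : I -> I -> I) (oplus odot : T -> T -> T) :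
  G `<=` U -> f @` U `<=` V ->
  (forall x y, U x -> U y -> U (add x y) ->
     oplus (f x) (f y) = f (add x y)) ->
  (forall x y, U x -> U y -> U (mul x y) ->
     odot (f x) (f y) = f (mul x y)) ->
  nearness_ring G U add mul -> nearness_ring (f @` G) V oplus odot.
Proof.
move=> GU fUV fadd fmul.
have fV x : U x -> V (f x) by move=> Ux; apply: fUV; exists x.
move=> [[[addU addA [e Ue [adde addV]]] addC] [G0 mulU mulA] mulDr mulDl].
have faddG x y : G x -> G y -> oplus (f x) (f y) = f (add x y).
  by move=> Gx Gy; apply: fadd; [exact: GU|exact: GU|exact: addU].
have fmulG x y : G x -> G y -> odot (f x) (f y) = f (mul x y).
  by move=> Gx Gy; apply: fmul; [exact: GU|exact: GU|exact: mulU].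
split.
- split; last first.
    move=> _ _ [x Gx <-] [y Gy <-]; have [/= xy Uxy] := addC _ _ Gx Gy.
    by rewrite !faddG// -xy; split=> //; exact: fV.
  split.
  + by move=> _ _ [x Gx <-] [y Gy <-]; rewrite faddG//; exact/fV/addU.
  + move=> _ _ _ [x Gx <-] [y Gy <-] [z Gz <-].
    have [/= xyz Uxyz] := addA _ _ _ Gx Gy Gz.
    rewrite (faddG x y)// (faddG y z)// !fadd -?xyz //;
      try exact: GU; try exact: addU.
    by split=> //; exact: fV.
  + exists (f e); first exact: fV.
    split=> [_ [x Gx <-]|_ [x Gx <-]].
      have [/= xe ex] := adde _ Gx; have Ux := GU _ Gx.
      by split; rewrite fadd ?xe ?ex.
    have [y Gy [/= xy yx]] := addV _ Gx.
    by exists (f y); [exists y|rewrite !faddG// xy yx].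
- split.
  + by case: G0 => x Gx; exists (f x); exists x.
  + by move=> _ _ [x Gx <-] [y Gy <-]; rewrite fmulG//; exact/fV/mulU.
  + move=> _ _ _ [x Gx <-] [y Gy <-] [z Gz <-].
    have [/= xyz Uxyz] := mulA _ _ _ Gx Gy Gz.
    rewrite (fmulG x y)// (fmulG y z)// !fmul -?xyz //;
      try exact: GU; try exact: mulU.
    by split=> //; exact: fV.
- move=> _ _ _ [x Gx <-] [y Gy <-] [z Gz <-].
  have [/= xyz Uxyz] := mulDr _ _ _ Gx Gy Gz.
  rewrite (faddG y z)// (fmulG x y)// (fmulG x z)// fmul ?fadd -?xyz //;
    try exact: GU; try exact: addU; try exact: mulU.
  by split=> //; exact: fV.
- move=> _ _ _ [x Gx <-] [y Gy <-] [z Gz <-].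
  have [/= xyz Uxyz] := mulDl _ _ _ Gx Gy Gz.
  rewrite (faddG x y)// (fmulG x z)// (fmulG y z)// fmul ?fadd -?xyz //;
    try exact: GU; try exact: addU; try exact: mulU.
  by split=> //; exact: fV.
Qed.

(** The blocks of any one partition cover the space, and a point of the upper
approximation comes with a partition. *)
Lemma sub_upper (K : realType) (O : nas K) (X : set O) :
  upper X !=set0 -> X `<=` upper X.
Proof.
move=> [_ [Br rBr _]] x Xx; exists Br => //; exists x; last by [].
by exists x.
Qed.

Lemma nearness_ring_sub_upper (K : realType) (O : nas K)
    (add mul : O -> O -> O) (R : set O) :
  nearness_ring R (upper R) add mul -> R `<=` upper R.
Proof.
move=> [_ [[x Rx] mulU _] _ _]; apply: sub_upper.
by exists (mul x x); exact: mulU.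
Qed.

Lemma coset_rep_mem (T : Type) (add : T -> T -> T) (R S : set T) (x : T) :
  weak_cosets add R S R (weak_coset add R S x) -> R x.
Proof.
move=> [r Rr rx]; have : weak_coset add R S x x by right.
by rewrite -rx => -[[s [_ Rrs] <-]//|->].
Qed.

Theorem theorem9 (K : realType) (O : nas K) (add mul : O -> O -> O)
    (L : nat) (phi : 'I_L -> O -> K) (hphi : forall i, probesB O (phi i))
    (R S : set O)
    (hR : nearness_ring R (upper R) add mul)
    (hS : subnearness_ring add mul R S)
    (hsub : weak_cosets add R S (upper R)
            `<=` upper_family phi (weak_cosets add R S R)) :
  coset_nearness_ring phi add mul R S /\
  (forall oplus odot : set O -> set O -> set O,
     coset_operation add R S add oplus ->
     coset_operation add R S mul odot ->
     nearness_ring (weak_cosets add R S R)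
       (upper_family phi (weak_cosets add R S R)) oplus odot).
Proof.
have RU := nearness_ring_sub_upper hR.
split; last first.
  by move=> oplus odot hplus hdot; exact: nearness_ring_image hplus hdot hR.
rewrite /coset_nearness_ring /=.
have -> : upper R `&` weak_coset add R S @^-1` weak_cosets add R S R = R.
  apply/seteqP; split=> x; first by case=> _; exact: coset_rep_mem.
  by move=> Rx; split; [exact: RU|exists x].
have -> : upper R `&` weak_coset add R S @^-1`
    upper_family phi (weak_cosets add R S R) = upper R.
  by apply/setIidPl => x Ux; apply: hsub; exists x.
exact: nearness_ring_viaW.
Qed.
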